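(* Let $\beta\in\mathbb{R}$ and consider the two problems $$\text{(A)}\quad -u''=u^3+\beta uv^2,\quad -v''=v^3+\beta u^2v\ \text{ in }\mathbb{R},\qquad u,v\in C_b^2(\mathbb{R}),$$ $$\text{(B)}\quad -u''=u^3+\beta uv^2,\quad -v''=v^3+\beta u^2v\ \text{ in }[0,\infty),\qquad u,v\in C_b^2([0,\infty))\text{ with }u'(0)=v'(0)=0.$$ If $\beta\neq-1$ and if $n(u+v),n(u-v)<\infty$, then problems (A) and (B) admit no nontrivial solutions $(u,v)$. If $\beta=-1$ and if $n(u+v),n(u-v)<\infty$, then any solution $(u,v)$ of problems (A) and (B) is of the form $(c,-c)$ for some constant $c\in\mathbb{R}$.
   Context: $C_b^2$ denotes $C^2$ functions bounded together with their derivatives up to order two. Nodal number: for a continuous function $u$ on an interval $I$ ($I=\mathbb{R}$ or $I=[0,\infty)$), $n(u)\in\mathbb{N}\cup\{\infty\}$ is the maximum (or $\infty$ if no maximum exists) nonnegative integer $m$ such that there are $x_0<x_1<\cdots<x_m$ in $I$ with $u(x_{j-1})u(x_j)<0$ for $j=1,\dots,m$.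
   Formalization: For β=−1 the formal conclusion is that (u,v) is of the form (c,c) or (c,−c), since the stated form (c,−c) alone fails: u=v=1 solves both problems with n(u+v)=n(u−v)=0. *)

(* Defs.v *)
From Stdlib Require Import Reals ClassicalEpsilon.
Open Scope R_scope.

(* A function on an interval I is represented by a total function R -> R whose
   values off I are irrelevant.  [D_in f d I x] and [continue_in f I x] take
   limits along I only, so they give the ordinary notions for I = R ([no_cond])
   and the one-sided ones at the endpoint of [halfline]. *)
Definition halfline (x : R) : Prop := 0 <= x.

Definition bounded_on (I : R -> Prop) (f : R -> R) : Prop :=
  exists M : R, forall x : R, I x -> Rabs (f x) <= M.

(* u is in C_b^2(I), with first and second derivatives u' and u'' on I. *)
Record Cb2 (I : R -> Prop) (u u' u'' : R -> R) : Prop := {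
  Cb2_deriv1 : forall x : R, I x -> D_in u u' I x;
  Cb2_deriv2 : forall x : R, I x -> D_in u' u'' I x;
  Cb2_cont : forall x : R, I x -> continue_in u'' I x;
  Cb2_bounded0 : bounded_on I u;
  Cb2_bounded1 : bounded_on I u';
  Cb2_bounded2 : bounded_on I u''
}.

Definition system (I : R -> Prop) (beta : R) (u v u'' v'' : R -> R) : Prop :=
  forall x : R, I x ->
    - u'' x = u x ^ 3 + beta * u x * v x ^ 2 /\
    - v'' x = v x ^ 3 + beta * u x ^ 2 * v x.

Definition solves_A (beta : R) (u v : R -> R) : Prop :=
  exists u' u'' v' v'' : R -> R,
    Cb2 no_cond u u' u'' /\ Cb2 no_cond v v' v'' /\
    system no_cond beta u v u'' v''.

Definition solves_B (beta : R) (u v : R -> R) : Prop :=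
  exists u' u'' v' v'' : R -> R,
    Cb2 halfline u u' u'' /\ Cb2 halfline v v' v'' /\
    system halfline beta u v u'' v'' /\
    u' 0 = 0 /\ v' 0 = 0.

Definition nontrivial (I : R -> Prop) (u v : R -> R) : Prop :=
  exists x : R, I x /\ (u x <> 0 \/ v x <> 0).

Definition sign_changes (I : R -> Prop) (u : R -> R) (m : nat) : Prop :=
  exists x : nat -> R,
    (forall j : nat, (j <= m)%nat -> I (x j)) /\
    (forall j : nat, (j < m)%nat -> x j < x (S j)) /\
    (forall j : nat, (j < m)%nat -> u (x j) * u (x (S j)) < 0).

Definition max_sign_changes (I : R -> Prop) (u : R -> R) (m : nat) : Prop :=
  sign_changes I u m /\
  forall k : nat, sign_changes I u k -> (k <= m)%nat.

(* n(u), with [None] standing for infinity. *)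
Definition nodal_number (I : R -> Prop) (u : R -> R) : option nat :=
  match excluded_middle_informative (exists m, max_sign_changes I u m) with
  | left H => Some (proj1_sig (constructive_indefinite_description _ H))
  | right _ => None
  end.

Definition finite_nodal (I : R -> Prop) (u : R -> R) : Prop :=
  nodal_number I u <> None.

Definition constant_pair (I : R -> Prop) (u v : R -> R) (c d : R) : Prop :=
  forall x : R, I x -> u x = c /\ v x = d.

(* Main.v *)
Require Import Defs.
From Stdlib Require Import Arith Reals Lra Lia Classical ClassicalEpsilon.
From Coquelicot Require Import Coquelicot.
Open Scope R_scope.

(** The proof rests on the conserved energy
    [H = u'^2 + v'^2 + (u^4 + v^4)/2 + beta u^2 v^2].

    If [H <= 0], the solution is constant: [(u^2 + v^2)'' = 6 (u'^2 + v'^2) - 4 H]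
    is then nonnegative, so [u^2 + v^2] is convex.  A bounded convex function is
    nonincreasing along a ray to [+oo], and it cannot decrease either, because of
    the ray to [-oo] in problem (A) and of [u'(0) = v'(0) = 0] in problem (B).
    Hence [u^2 + v^2] is constant, its second derivative vanishes, and so do [u']
    and [v'].  The constants solve [u (u^2 + beta v^2) = v (v^2 + beta u^2) = 0],
    which forces [u = v = 0] unless [beta = -1], in which case [u^2 = v^2].

    That [H <= 0] is where the finite nodal numbers enter
    ([finite_nodal_eventually_signed], [energy_nonpos]): they make [u + v] and
    [u - v] eventually of constant sign.  Swapping [u] and [v] or changing the sign
    of both preserves the system and the energy, so one may assume [u + v >= 0] and
    [u - v >= 0], that is [|v| <= u], far to the right
    ([energy_nonpos_dominated]).  There are two possibilities.

    - [u] takes arbitrarily small values there.  At such a point the nonnegative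
      functions [u + v] and [u - v] are small with bounded second derivatives, hence
      also have small slopes; so all terms of [H] are small, and [H <= 0] by
      conservation ([energy_nonpos_of_small]).

    - [u] stays above some [d > 0].  If [beta > -1], then
      [u'' = - u (u^2 + beta v^2)] is at most a negative constant, which is
      absurd as [u'] is bounded.  If [beta < -1], then [v^2] is convex and in fact
      decays to [0], because its convexity is controlled by [v^2] itself; after
      which [u''] is again at most a negative constant.  If [beta = -1], then
      [u'' = - u (u^2 - v^2)], and the same argument shows [u^2 = v^2] on the ray, so
      [u] and [v] are affine, hence constant, and [H = 0]. *)

(** * Bounded functions on a ray *)

Lemma ray_mvt (X : R) (f f' : R -> R) :
  (forall x, X < x -> is_derive f x (f' x)) ->
  forall a b, X < a -> a < b ->
  exists c, a < c < b /\ f b - f a = f' c * (b - a).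
Proof.
  intros Hf a b Ha Hab.
  destruct (MVT_cor2 f f' a b Hab) as [c [Hc Hcab]].
  - intros c Hc. apply is_derive_Reals, Hf. lra.
  - exists c. auto.
Qed.

Lemma ray_le (X : R) (f f' : R -> R) :
  (forall x, X < x -> is_derive f x (f' x)) ->
  (forall x, X < x -> 0 <= f' x) ->
  forall a b, X < a -> a <= b -> f a <= f b.
Proof.
  intros Hf Hpos a b Ha [Hab | ->]; [|lra].
  destruct (ray_mvt X f f' Hf a b Ha Hab) as [c [Hc E]].
  assert (0 <= f' c) by (apply Hpos; lra). nra.
Qed.

Lemma bounded_slope_false (X : R) (f f' : R -> R) (c M : R) :
  0 < c ->
  (forall x, X < x -> is_derive f x (f' x)) ->
  (forall x, X < x -> Rabs (f x) <= M) ->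
  (forall x, X < x -> c <= f' x) ->
  False.
Proof.
  intros Hc Hf HM Hge.
  assert (HM0 : 0 <= M).
  { apply Rle_trans with (Rabs (f (X + 1))); [apply Rabs_pos | apply HM; lra]. }
  assert (Hlen : 0 < (2 * M + 1) / c) by (apply Rdiv_lt_0_compat; lra).
  set (L := (2 * M + 1) / c) in *.
  assert (HL : c * L = 2 * M + 1) by (unfold L; field; lra).
  destruct (ray_mvt X f f' Hf (X + 1) (X + 1 + L)) as [d [Hd E]]; try lra.
  assert (c <= f' d) by (apply Hge; lra).
  assert (H1 := HM (X + 1) ltac:(lra)). assert (H2 := HM (X + 1 + L) ltac:(lra)).
  apply Rabs_le_between in H1. apply Rabs_le_between in H2.
  replace (X + 1 + L - (X + 1)) with L in E by ring.
  nra.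
Qed.

Lemma bounded_convex_decreasing (X : R) (f f' f'' : R -> R) (M : R) :
  (forall x, X < x -> is_derive f x (f' x)) ->
  (forall x, X < x -> is_derive f' x (f'' x)) ->
  (forall x, X < x -> Rabs (f x) <= M) ->
  (forall x, X < x -> 0 <= f'' x) ->
  forall x, X < x -> f' x <= 0.
Proof.
  intros Hf Hf' HM Hconv x Hx.
  apply Rnot_lt_le. intros Hpos.
  apply (bounded_slope_false x f f' (f' x) M Hpos).
  - intros y Hy. apply Hf. lra.
  - intros y Hy. apply HM. lra.
  - intros y Hy. apply (ray_le X f' f'' Hf' Hconv); lra.
Qed.

Lemma bounded_affine_constant (X : R) (f f' f'' : R -> R) (M : R) :
  (forall x, X < x -> is_derive f x (f' x)) ->
  (forall x, X < x -> is_derive f' x (f'' x)) ->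
  (forall x, X < x -> Rabs (f x) <= M) ->
  (forall x, X < x -> f'' x = 0) ->
  forall x, X < x -> f' x = 0.
Proof.
  intros Hf Hf' HM H0 x Hx.
  apply Rle_antisym.
  - apply (bounded_convex_decreasing X f f' f'' M Hf Hf' HM); auto.
    intros y Hy. rewrite H0; lra.
  - enough (- f' x <= 0) by lra.
    apply (bounded_convex_decreasing X (fun y => - f y) (fun y => - f' y)
      (fun y => - f'' y) M); auto; intros y Hy.
    + apply (is_derive_opp f), Hf, Hy.
    + apply (is_derive_opp f'), Hf', Hy.
    + rewrite Rabs_Ropp. auto.
    + rewrite H0; lra.
Qed.

(** A Landau inequality.  If [|f' x|] were large compared with [f x / h + N h], the
    bound on [f''] would keep the slope large on all of [x - h, x + h] and [f] would
    become negative at one of the two ends. *)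
Lemma nonneg_slope_bound (X : R) (f f' f'' : R -> R) (N x h : R) :
  (forall y, X < y -> is_derive f y (f' y)) ->
  (forall y, X < y -> is_derive f' y (f'' y)) ->
  (forall y, X < y -> 0 <= f y) ->
  (forall y, X < y -> Rabs (f'' y) <= N) ->
  0 < h -> X + h < x ->
  Rabs (f' x) * h <= f x + N * h ^ 2.
Proof.
  intros Hf Hf' Hpos HN Hh Hx.
  assert (HN0 : 0 <= N).
  { apply Rle_trans with (Rabs (f'' x)); [apply Rabs_pos | apply HN; lra]. }
  destruct (ray_mvt X f f' Hf x (x + h)) as [c [Hc E]]; try lra.
  destruct (ray_mvt X f' f'' Hf' x c) as [c' [Hc' E']]; try lra.
  destruct (ray_mvt X f f' Hf (x - h) x) as [d [Hd F]]; try lra.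
  destruct (ray_mvt X f' f'' Hf' d x) as [d' [Hd' F']]; try lra.
  assert (P1 := Hpos (x + h) ltac:(lra)). assert (P2 := Hpos (x - h) ltac:(lra)).
  assert (B1 := HN c' ltac:(lra)). assert (B2 := HN d' ltac:(lra)).
  apply Rabs_le_between in B1. apply Rabs_le_between in B2.
  assert (Up : f' c - f' x <= N * h).
  { rewrite E'. apply Rle_trans with (N * (c - x));
      [apply Rmult_le_compat_r | apply Rmult_le_compat_l]; lra. }
  assert (Dn : f' x - f' d <= N * h).
  { rewrite F'. apply Rle_trans with (N * (x - d));
      [apply Rmult_le_compat_r | apply Rmult_le_compat_l]; lra. }
  unfold Rabs. destruct (Rcase_abs (f' x)); nra.
Qed.

(** * Solutions on a ray and their energy *)

(** The ray is open so that one notion, with two-sided derivatives, serves both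
    problems: for (A) it is used on every ray, for (B) on the interior of
    the half-line. *)
Record bounded_ray_solution (X beta M : R) (u u' v v' : R -> R) : Prop := {
  sol_u : forall x, X < x -> is_derive u x (u' x);
  sol_u' : forall x, X < x -> is_derive u' x (- (u x ^ 3 + beta * u x * v x ^ 2));
  sol_v : forall x, X < x -> is_derive v x (v' x);
  sol_v' : forall x, X < x -> is_derive v' x (- (v x ^ 3 + beta * u x ^ 2 * v x));
  bound_u : forall x, X < x -> Rabs (u x) <= M;
  bound_u' : forall x, X < x -> Rabs (u' x) <= M;
  bound_v : forall x, X < x -> Rabs (v x) <= M;
  bound_v' : forall x, X < x -> Rabs (v' x) <= M
}.

Definition energy (beta : R) (u u' v v' : R -> R) (x : R) : R :=
  u' x ^ 2 + v' x ^ 2 + (u x ^ 4 + v x ^ 4) / 2 + beta * u x ^ 2 * v x ^ 2.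

Lemma solution_subray X Y beta M u u' v v' :
  X <= Y ->
  bounded_ray_solution X beta M u u' v v' -> bounded_ray_solution Y beta M u u' v v'.
Proof.
  intros HXY [? ? ? ? ? ? ? ?].
  split; intros x Hx; match goal with H : _ |- _ => apply H; lra end.
Qed.

Lemma solution_swap X beta M u u' v v' :
  bounded_ray_solution X beta M u u' v v' -> bounded_ray_solution X beta M v v' u u'.
Proof.
  intros [? H1 ? H2 ? ? ? ?]. split; auto.
  - intros x Hx. replace (beta * v x * u x ^ 2) with (beta * u x ^ 2 * v x) by ring. auto.
  - intros x Hx. replace (beta * v x ^ 2 * u x) with (beta * u x * v x ^ 2) by ring. auto.
Qed.

Lemma solution_opp X beta M u u' v v' :
  bounded_ray_solution X beta M u u' v v' ->
  bounded_ray_solution X beta M (fun x => - u x) (fun x => - u' x)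
    (fun x => - v x) (fun x => - v' x).
Proof.
  intros [H1 H2 H3 H4 ? ? ? ?].
  split; intros x Hx; try (rewrite Rabs_Ropp; auto).
  - apply (is_derive_opp u), H1, Hx.
  - replace (- _) with (opp (- (u x ^ 3 + beta * u x * v x ^ 2))) by (unfold opp; simpl; ring).
    apply (is_derive_opp u'), H2, Hx.
  - apply (is_derive_opp v), H3, Hx.
  - replace (- _) with (opp (- (v x ^ 3 + beta * u x ^ 2 * v x))) by (unfold opp; simpl; ring).
    apply (is_derive_opp v'), H4, Hx.
Qed.

(** The eta-expanded form is the one in which [auto_derive] leaves the derivative of
    an unknown function. *)
Lemma Derive_eta (f : R -> R) (x l : R) :
  is_derive f x l -> Derive (fun y : R => f y) x = l.
Proof. apply is_derive_unique. Qed.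

Lemma is_derive_sqr_sum f f' g g' x :
  is_derive f x f' -> is_derive g x g' ->
  is_derive (fun y => f y ^ 2 + g y ^ 2) x (2 * (f x * f' + g x * g')).
Proof.
  intros Hf Hg. auto_derive.
  - repeat split; eexists; eassumption.
  - rewrite (Derive_eta _ _ _ Hf),
      (Derive_eta _ _ _ Hg). ring.
Qed.

Lemma energy_constant X beta M u u' v v' :
  bounded_ray_solution X beta M u u' v v' ->
  forall a b, X < a -> X < b -> energy beta u u' v v' a = energy beta u u' v v' b.
Proof.
  intros [H1 H2 H3 H4 _ _ _ _].
  assert (D : forall x, X < x -> is_derive (energy beta u u' v v') x 0).
  { intros x Hx. specialize (H1 x Hx). specialize (H2 x Hx).
    specialize (H3 x Hx). specialize (H4 x Hx).
    unfold energy. auto_derive.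
    - repeat split; eexists; eassumption.
    - rewrite (Derive_eta _ _ _ H1), (Derive_eta _ _ _ H2),
        (Derive_eta _ _ _ H3), (Derive_eta _ _ _ H4). field. }
  assert (Hlt : forall a b, X < a -> a < b ->
    energy beta u u' v v' a = energy beta u u' v v' b).
  { intros a b Ha Hab.
    destruct (ray_mvt X _ (fun _ => 0) D a b Ha Hab) as [c [_ E]]. lra. }
  intros a b Ha Hb. destruct (Rtotal_order a b) as [H | [-> | H]]; auto.
  symmetry. auto.
Qed.

(** * Where the larger component is small *)

Lemma cubic_bound beta M p q :
  Rabs p <= M -> Rabs q <= M ->
  Rabs (- (p ^ 3 + beta * p * q ^ 2)) <= (1 + Rabs beta) * M ^ 3.
Proof.
  intros Hp Hq.
  assert (HM := Rabs_pos p). assert (Hq0 := Rabs_pos q). assert (Hb := Rabs_pos beta).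
  rewrite Rabs_Ropp. eapply Rle_trans; [apply Rabs_triang|].
  rewrite !Rabs_mult, <- !RPow_abs.
  assert (Rabs p ^ 3 <= M ^ 3) by (apply pow_incr; lra).
  assert (Rabs q ^ 2 <= M ^ 2) by (apply pow_incr; lra).
  assert (0 <= Rabs q ^ 2) by (apply pow_le; lra).
  assert (Rabs p * Rabs q ^ 2 <= M * M ^ 2) by (apply Rmult_le_compat; lra).
  replace ((1 + Rabs beta) * M ^ 3) with (M ^ 3 + Rabs beta * (M * M ^ 2)) by ring.
  apply Rplus_le_compat; [assumption|].
  rewrite Rmult_assoc. apply Rmult_le_compat_l; assumption.
Qed.

(** The second derivatives of [u + v] and [u - v] are at most
    [2 (1 + |beta|) M^3]; the Landau inequality with step [e] applies to both, since
    both are nonnegative and at most [2 e^2] at [x]. *)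
Lemma derivative_bound_near_zero X beta M u u' v v' e x :
  bounded_ray_solution X beta M u u' v v' ->
  (forall y, X < y -> Rabs (v y) <= u y) ->
  0 < e -> X + e < x -> u x < e ^ 2 ->
  let C := 2 + 2 * ((1 + Rabs beta) * M ^ 3) in
  Rabs (u' x) <= C * e /\ Rabs (v' x) <= C * e.
Proof.
  intros S Hdom He Hx Hsmall C.
  destruct S as [H1 H2 H3 H4 Bu _ Bv _].
  assert (Hw : Rabs (u' x + v' x) * e <= (u x + v x) + (C - 2) * e ^ 2).
  { apply (nonneg_slope_bound X (fun y => u y + v y) (fun y => u' y + v' y)
      (fun y => - (u y ^ 3 + beta * u y * v y ^ 2) + - (v y ^ 3 + beta * u y ^ 2 * v y)));
      auto; intros y Hy.
    - apply (is_derive_plus u v); auto.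
    - apply (is_derive_plus u' v'); auto.
    - specialize (Hdom y Hy). apply Rabs_le_between in Hdom. lra.
    - eapply Rle_trans; [apply Rabs_triang|].
      assert (K1 := cubic_bound beta M _ _ (Bu y Hy) (Bv y Hy)).
      assert (K2 := cubic_bound beta M _ _ (Bv y Hy) (Bu y Hy)).
      replace (beta * v y * u y ^ 2) with (beta * u y ^ 2 * v y) in K2 by ring.
      unfold C. lra. }
  assert (Hz : Rabs (u' x - v' x) * e <= (u x - v x) + (C - 2) * e ^ 2).
  { apply (nonneg_slope_bound X (fun y => u y - v y) (fun y => u' y - v' y)
      (fun y => - (u y ^ 3 + beta * u y * v y ^ 2) - - (v y ^ 3 + beta * u y ^ 2 * v y)));
      auto; intros y Hy.
    - apply (is_derive_minus u v); auto.
    - apply (is_derive_minus u' v'); auto.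
    - specialize (Hdom y Hy). apply Rabs_le_between in Hdom. lra.
    - eapply Rle_trans; [apply Rabs_triang|]. rewrite (Rabs_Ropp (- _)).
      assert (K1 := cubic_bound beta M _ _ (Bu y Hy) (Bv y Hy)).
      assert (K2 := cubic_bound beta M _ _ (Bv y Hy) (Bu y Hy)).
      replace (beta * v y * u y ^ 2) with (beta * u y ^ 2 * v y) in K2 by ring.
      unfold C. lra. }
  specialize (Hdom x ltac:(lra)). apply Rabs_le_between in Hdom.
  assert (Hw' : Rabs (u' x + v' x) <= C * e) by (apply Rmult_le_reg_r with e; nra).
  assert (Hz' : Rabs (u' x - v' x) <= C * e) by (apply Rmult_le_reg_r with e; nra).
  apply Rabs_le_between in Hw'. apply Rabs_le_between in Hz'.
  split; apply Rabs_le_between; lra.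
Qed.

(** All terms of the energy are of order [e] at a point where [u < e^2], and the
    energy is the same at all points. *)
Lemma energy_nonpos_of_small X beta M u u' v v' :
  bounded_ray_solution X beta M u u' v v' ->
  (forall y, X < y -> Rabs (v y) <= u y) ->
  (forall d, 0 < d -> exists x, X + 1 < x /\ u x < d) ->
  forall x, X < x -> energy beta u u' v v' x <= 0.
Proof.
  intros S Hdom Hinf x Hx.
  set (C := 2 + 2 * ((1 + Rabs beta) * M ^ 3)).
  set (D := 2 * C ^ 2 + 1 + Rabs beta).
  assert (Hb := Rabs_pos beta).
  assert (HD : 0 < D) by (unfold D; nra).
  assert (small : forall e, 0 < e -> e <= 1 -> energy beta u u' v v' x <= D * e).
  { intros e He He1.
    destruct (Hinf (e ^ 2)) as [y [Hy Hu]]; [nra|].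
    rewrite (energy_constant _ _ _ _ _ _ _ S x y) by lra.
    destruct (derivative_bound_near_zero _ _ _ _ _ _ _ e y S Hdom He) as [B1 B2]; try lra.
    fold C in B1, B2.
    specialize (Hdom y ltac:(lra)).
    assert (Hv0 := Rabs_pos (v y)).
    assert (Q1 : u' y ^ 2 <= (C * e) ^ 2) by (apply pow_maj_Rabs; assumption).
    assert (Q2 : v' y ^ 2 <= (C * e) ^ 2) by (apply pow_maj_Rabs; assumption).
    assert (Hue : u y <= e) by nra.
    assert (Q3 : u y ^ 2 <= e) by nra.
    assert (Q4 : v y ^ 2 <= e).
    { apply Rle_trans with (u y ^ 2); [apply pow_maj_Rabs|]; assumption. }
    assert (P3 := pow2_ge_0 (u y)). assert (P4 := pow2_ge_0 (v y)).
    assert (Q5 : beta * u y ^ 2 * v y ^ 2 <= Rabs beta * e).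
    { assert (u y ^ 2 * v y ^ 2 <= e) by nra.
      assert (beta <= Rabs beta) by apply Rle_abs.
      assert (0 <= u y ^ 2 * v y ^ 2) by nra.
      rewrite Rmult_assoc. nra. }
    unfold energy, D.
    replace (u y ^ 4) with (u y ^ 2 * u y ^ 2) by ring.
    replace (v y ^ 4) with (v y ^ 2 * v y ^ 2) by ring.
    assert (C ^ 2 * e ^ 2 <= C ^ 2 * e) by (apply Rmult_le_compat_l; nra).
    nra. }
  apply Rnot_lt_le. intros HE.
  set (E := energy beta u u' v v' x) in *.
  set (e := Rmin 1 (E / (2 * D))).
  assert (He : 0 < e).
  { apply Rmin_glb_lt; [lra|]. apply Rdiv_lt_0_compat; lra. }
  assert (He2 : e <= E / (2 * D)) by apply Rmin_r.
  specialize (small e He (Rmin_l _ _)).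
  assert (D * e <= D * (E / (2 * D))) by (apply Rmult_le_compat_l; lra).
  replace (D * (E / (2 * D))) with (E / 2) in H by (field; lra).
  lra.
Qed.


(** * Where the larger component stays away from zero *)

(** With [|v| <= u], [u^2 + beta v^2 >= min(1, 1 + beta) u^2], so [u'' <= - m d^3]
    with [m > 0], although [u'] is bounded. *)
Lemma no_uniform_lower_bound_above X beta M u u' v v' d :
  -1 < beta ->
  bounded_ray_solution X beta M u u' v v' ->
  (forall y, X < y -> Rabs (v y) <= u y) ->
  0 < d -> (forall y, X < y -> d <= u y) -> False.
Proof.
  intros Hb [_ H2 _ _ _ Bu' _ _] Hdom Hd Hu.
  assert (Hm : 0 < Rmin 1 (1 + beta)) by (apply Rmin_glb_lt; lra).
  set (m := Rmin 1 (1 + beta)) in *.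
  apply (bounded_slope_false X (fun y => - u' y) (fun y => - - (u y ^ 3 + beta * u y * v y ^ 2))
    (m * d ^ 3) M).
  - apply Rmult_lt_0_compat; [|apply pow_lt]; lra.
  - intros y Hy. apply (is_derive_opp u'), H2, Hy.
  - intros y Hy. rewrite Rabs_Ropp. auto.
  - intros y Hy. specialize (Hdom y Hy). specialize (Hu y Hy).
    assert (Hvu : v y ^ 2 <= u y ^ 2) by (apply pow_maj_Rabs; assumption).
    assert (P := pow2_ge_0 (v y)).
    assert (m <= 1) by apply Rmin_l. assert (m <= 1 + beta) by apply Rmin_r.
    assert (Hc : m * u y ^ 2 <= u y ^ 2 + beta * v y ^ 2).
    { destruct (Rle_lt_dec 0 beta); nra. }
    assert (Hd3 : d ^ 3 <= u y ^ 3) by (apply pow_incr; lra).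
    replace (- - (u y ^ 3 + beta * u y * v y ^ 2)) with (u y * (u y ^ 2 + beta * v y ^ 2)) by ring.
    apply Rle_trans with (m * u y ^ 3); [apply Rmult_le_compat_l; lra|].
    replace (m * u y ^ 3) with (u y * (m * u y ^ 2)) by ring.
    apply Rmult_le_compat_l; lra.
Qed.

Lemma is_derive_slope_sqr X beta M u u' v v' :
  bounded_ray_solution X beta M u u' v v' ->
  forall x, X < x ->
  is_derive (fun y => 2 * (v y * v' y)) x
    (2 * v' x ^ 2 - 2 * v x ^ 2 * (beta * u x ^ 2 + v x ^ 2)).
Proof.
  intros [_ _ H3 H4 _ _ _ _] x Hx.
  specialize (H3 x Hx). specialize (H4 x Hx). auto_derive.
  - repeat split; eexists; eassumption.
  - rewrite (Derive_eta _ _ _ H3), (Derive_eta _ _ _ H4). ring.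
Qed.

Lemma is_derive_sqr (f : R -> R) (x l : R) :
  is_derive f x l -> is_derive (fun y => f y ^ 2) x (2 * (f x * l)).
Proof.
  intros H. auto_derive.
  - eexists; eassumption.
  - rewrite (Derive_eta _ _ _ H). ring.
Qed.

(** [v'' = - v (v^2 + beta u^2)], where the bracket is at most
    [v^2 - u^2 <= 0]: the square [v^2] is convex, and it is bounded. *)
Lemma small_component_decreasing X beta M u u' v v' :
  beta <= -1 ->
  bounded_ray_solution X beta M u u' v v' ->
  (forall y, X < y -> Rabs (v y) <= u y) ->
  forall a b, X < a -> a <= b -> v b ^ 2 <= v a ^ 2.
Proof.
  intros Hb S Hdom a b Ha Hab.
  assert (D := fun x Hx => is_derive_sqr v x (v' x) (sol_v _ _ _ _ _ _ _ S x Hx)).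
  assert (D' := is_derive_slope_sqr _ _ _ _ _ _ _ S).
  assert (Hdec : forall x, X < x -> 2 * (v x * v' x) <= 0).
  { apply (bounded_convex_decreasing X _ _ _ (M ^ 2) D D').
    - intros x Hx. rewrite <- RPow_abs. apply pow_incr. split; [apply Rabs_pos|].
      apply (bound_v _ _ _ _ _ _ _ S x Hx).
    - intros x Hx.
      assert (Hvu : v x ^ 2 <= u x ^ 2) by (apply pow_maj_Rabs; auto).
      assert (P := pow2_ge_0 (v x)). assert (P' := pow2_ge_0 (v' x)).
      assert (beta * u x ^ 2 + v x ^ 2 <= 0) by nra.
      nra. }
  apply Ropp_le_cancel.
  apply (ray_le X (fun y => - v y ^ 2) (fun y => - (2 * (v y * v' y)))); auto.
  - intros x Hx. apply (is_derive_opp (fun y => v y ^ 2)), D, Hx.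
  - intros x Hx. specialize (Hdec x Hx). lra.
Qed.

(** Once [v^2] is below the threshold [q], it remains so, and
    [u'' <= - u (u^2 - d^2/2)] stays below a negative constant.  If [v^2] never gets
    below [q], then [(v^2)''] is bounded away from zero.  Either way a bounded slope
    would grow without bound. *)
Lemma no_uniform_lower_bound_below X beta M u u' v v' d :
  beta < -1 ->
  bounded_ray_solution X beta M u u' v v' ->
  (forall y, X < y -> Rabs (v y) <= u y) ->
  0 < d -> (forall y, X < y -> d <= u y) -> False.
Proof.
  intros Hb S Hdom Hd Hu.
  assert (Hdec := small_component_decreasing _ _ _ _ _ _ _ (Rlt_le _ _ Hb) S Hdom).
  (* for this [q], [|beta| v^2 <= d^2 / 2] as soon as [v^2 <= q] *)
  set (q := d ^ 2 / (2 * - beta)).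
  assert (Hq : 0 < q) by (apply Rdiv_lt_0_compat; nra).
  assert (Eq : - beta * q = d ^ 2 / 2) by (unfold q; field; lra).
  destruct (classic (exists x, X < x /\ v x ^ 2 <= q)) as [[x [Hx Hvx]] | Hno].
  - apply (bounded_slope_false x (fun y => - u' y)
      (fun y => - - (u y ^ 3 + beta * u y * v y ^ 2)) (d * (d ^ 2 / 2)) M).
    + assert (0 < d ^ 2) by (apply pow_lt; lra). apply Rmult_lt_0_compat; lra.
    + intros y Hy. apply (is_derive_opp u'), (sol_u' _ _ _ _ _ _ _ S). lra.
    + intros y Hy. rewrite Rabs_Ropp. apply (bound_u' _ _ _ _ _ _ _ S). lra.
    + intros y Hy. specialize (Hdec x y Hx ltac:(lra)). specialize (Hu y ltac:(lra)).
      replace (- - (u y ^ 3 + beta * u y * v y ^ 2))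
        with (u y * (u y ^ 2 - - beta * v y ^ 2)) by ring.
      assert (- beta * v y ^ 2 <= - beta * q) by (apply Rmult_le_compat_l; lra).
      assert (d ^ 2 <= u y ^ 2) by (apply pow_incr; lra).
      apply Rmult_le_compat; nra.
  - assert (Hv : forall y, X < y -> q <= v y ^ 2).
    { intros y Hy. apply Rnot_lt_le. intros Hlt. apply Hno. exists y. lra. }
    apply (bounded_slope_false X (fun y => 2 * (v y * v' y))
      (fun x => 2 * v' x ^ 2 - 2 * v x ^ 2 * (beta * u x ^ 2 + v x ^ 2))
      (2 * q * ((- beta - 1) * d ^ 2)) (2 * (M * M))).
    + assert (0 < d ^ 2) by (apply pow_lt; lra).
      apply Rmult_lt_0_compat; [lra|]. apply Rmult_lt_0_compat; lra.
    + exact (is_derive_slope_sqr _ _ _ _ _ _ _ S).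
    + intros y Hy. rewrite !Rabs_mult, (Rabs_pos_eq 2) by lra.
      apply Rmult_le_compat_l; [lra|].
      apply Rmult_le_compat; try apply Rabs_pos;
        [apply (bound_v _ _ _ _ _ _ _ S) | apply (bound_v' _ _ _ _ _ _ _ S)]; lra.
    + intros y Hy. specialize (Hv y Hy). specialize (Hu y Hy).
      assert (Hvu : v y ^ 2 <= u y ^ 2) by (apply pow_maj_Rabs; auto).
      assert (Hd2 : d ^ 2 <= u y ^ 2) by (apply pow_incr; lra).
      assert (P' := pow2_ge_0 (v' y)).
      assert ((- beta - 1) * d ^ 2 <= - (beta * u y ^ 2 + v y ^ 2)) by nra.
      assert (0 <= (- beta - 1) * d ^ 2) by nra.
      assert (q * ((- beta - 1) * d ^ 2) <= v y ^ 2 * - (beta * u y ^ 2 + v y ^ 2))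
        by (apply Rmult_le_compat; lra).
      lra.
Qed.

(** For [beta = -1] the system reads [u'' = - u (u^2 - v^2)], [v'' = v (u^2 - v^2)].
    As [u] is concave and [v^2] convex, [u^2 - v^2] is nondecreasing; a positive
    value would bound [u''] away from zero from there on.  So it vanishes, both
    components are affine and bounded, hence constant, and the energy
    [u'^2 + v'^2 + (u^2 - v^2)^2 / 2] is zero. *)
Lemma critical_energy_nonpos X M u u' v v' d :
  bounded_ray_solution X (-1) M u u' v v' ->
  (forall y, X < y -> Rabs (v y) <= u y) ->
  0 < d -> (forall y, X < y -> d <= u y) ->
  forall x, X < x -> energy (-1) u u' v v' x <= 0.
Proof.
  intros S Hdom Hd Hu.
  assert (Hvu : forall y, X < y -> v y ^ 2 <= u y ^ 2).
  { intros y Hy. apply pow_maj_Rabs; auto. }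
  assert (Hvdec := small_component_decreasing _ _ _ _ _ _ _ (Rle_refl (-1)) S Hdom).
  assert (E2 : forall y, - - (u y ^ 3 + -1 * u y * v y ^ 2) = u y * (u y ^ 2 - v y ^ 2))
    by (intros; ring).
  assert (Du : forall x, X < x -> is_derive (fun y => - u y) x (- u' x)).
  { intros x Hx. apply (is_derive_opp u), (sol_u _ _ _ _ _ _ _ S), Hx. }
  assert (Du' : forall x, X < x -> is_derive (fun y => - u' y) x (u x * (u x ^ 2 - v x ^ 2))).
  { intros x Hx. rewrite <- E2. apply (is_derive_opp u'), (sol_u' _ _ _ _ _ _ _ S), Hx. }
  assert (Hu' : forall x, X < x -> - u' x <= 0).
  { apply (bounded_convex_decreasing X _ _ _ M Du Du').
    - intros x Hx. rewrite Rabs_Ropp. apply (bound_u _ _ _ _ _ _ _ S), Hx.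
    - intros x Hx. specialize (Hvu x Hx). specialize (Hu x Hx). nra. }
  assert (Huinc : forall a b, X < a -> a <= b -> u a <= u b).
  { apply (ray_le X u u' (sol_u _ _ _ _ _ _ _ S)). intros x Hx. specialize (Hu' x Hx). lra. }
  assert (Heq : forall x, X < x -> u x ^ 2 - v x ^ 2 = 0).
  { intros x Hx. apply Rle_antisym; [|specialize (Hvu x Hx); lra].
    apply Rnot_lt_le. intros Hpos.
    apply (bounded_slope_false x (fun y => - u' y) (fun y => u y * (u y ^ 2 - v y ^ 2))
      (d * (u x ^ 2 - v x ^ 2)) M).
    - nra.
    - intros y Hy. apply Du'. lra.
    - intros y Hy. rewrite Rabs_Ropp. apply (bound_u' _ _ _ _ _ _ _ S). lra.
    - intros y Hy. specialize (Huinc x y Hx ltac:(lra)). specialize (Hvdec x y Hx ltac:(lra)).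
      specialize (Hu x Hx) as Hux. specialize (Hu y ltac:(lra)).
      assert (u x ^ 2 <= u y ^ 2) by (apply pow_incr; lra).
      apply Rmult_le_compat; lra. }
  intros x Hx. unfold energy.
  rewrite (bounded_affine_constant X u u' _ M (sol_u _ _ _ _ _ _ _ S) (sol_u' _ _ _ _ _ _ _ S)
    (bound_u _ _ _ _ _ _ _ S)); auto.
  2:{ intros y Hy. specialize (Heq y Hy).
      replace (- _) with (- u y * (u y ^ 2 - v y ^ 2)) by ring. rewrite Heq. ring. }
  rewrite (bounded_affine_constant X v v' _ M (sol_v _ _ _ _ _ _ _ S) (sol_v' _ _ _ _ _ _ _ S)
    (bound_v _ _ _ _ _ _ _ S)); auto.
  2:{ intros y Hy. specialize (Heq y Hy).
      replace (- _) with (v y * (u y ^ 2 - v y ^ 2)) by ring. rewrite Heq. ring. }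
  replace (_ + _) with ((u x ^ 2 - v x ^ 2) ^ 2 / 2) by field.
  rewrite (Heq x Hx). lra.
Qed.

(** * Nonpositivity of the energy *)

Lemma energy_nonpos_dominated X beta M u u' v v' :
  bounded_ray_solution X beta M u u' v v' ->
  (forall y, X < y -> Rabs (v y) <= u y) ->
  forall x, X < x -> energy beta u u' v v' x <= 0.
Proof.
  intros S Hdom x Hx.
  destruct (classic (exists d, 0 < d /\ forall y, X + 1 < y -> d <= u y))
    as [[d [Hd Hu]] | Hno].
  - assert (S1 := solution_subray X (X + 1) _ _ _ _ _ _ ltac:(lra) S).
    assert (Hdom1 : forall y, X + 1 < y -> Rabs (v y) <= u y).
    { intros y Hy. apply Hdom. lra. }
    destruct (Rtotal_order beta (-1)) as [Hb | [-> | Hb]].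
    + exfalso. exact (no_uniform_lower_bound_below _ _ _ _ _ _ _ d Hb S1 Hdom1 Hd Hu).
    + rewrite (energy_constant _ _ _ _ _ _ _ S x (X + 2)) by lra.
      apply (critical_energy_nonpos _ _ _ _ _ _ d S1 Hdom1 Hd Hu). lra.
    + exfalso. exact (no_uniform_lower_bound_above _ _ _ _ _ _ _ d Hb S1 Hdom1 Hd Hu).
  - apply (energy_nonpos_of_small X _ M); auto.
    intros d Hd. apply NNPP. intros Hall. apply Hno.
    exists d. split; [exact Hd|]. intros y Hy. apply Rnot_lt_le. intros Hlt.
    apply Hall. exists y. auto.
Qed.

Definition eventually_signed (f : R -> R) : Prop :=
  exists Y, (forall y, Y < y -> 0 <= f y) \/ (forall y, Y < y -> f y <= 0).

Lemma energy_swap beta u u' v v' x : energy beta v v' u u' x = energy beta u u' v v' x.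
Proof. unfold energy. field. Qed.

Lemma energy_opp beta u u' v v' x :
  energy beta (fun y => - u y) (fun y => - u' y) (fun y => - v y) (fun y => - v' y) x
    = energy beta u u' v v' x.
Proof. unfold energy. field. Qed.

(** The four sign patterns of [u + v] and [u - v] are exchanged by the symmetries
    [(u, v) -> (v, u)] and [(u, v) -> (- u, - v)]. *)
Lemma energy_nonpos X beta M u u' v v' :
  bounded_ray_solution X beta M u u' v v' ->
  eventually_signed (fun x => u x + v x) ->
  eventually_signed (fun x => u x - v x) ->
  forall x, X < x -> energy beta u u' v v' x <= 0.
Proof.
  intros S [Y1 Hw] [Y2 Hz] x Hx.
  set (Y := Rmax X (Rmax Y1 Y2)).
  assert (HX : X <= Y) by apply Rmax_l.
  assert (HY1 : Y1 <= Y) by (eapply Rle_trans; [apply Rmax_l | apply Rmax_r]).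
  assert (HY2 : Y2 <= Y) by (eapply Rle_trans; [apply Rmax_r | apply Rmax_r]).
  rewrite (energy_constant _ _ _ _ _ _ _ S x (Y + 1)) by lra.
  assert (S' := solution_subray X Y _ _ _ _ _ _ HX S).
  clearbody Y.
  destruct Hw as [Hw | Hw], Hz as [Hz | Hz].
  - apply (energy_nonpos_dominated Y _ M); [exact S' | | lra].
    intros y Hy. specialize (Hw y ltac:(lra)). specialize (Hz y ltac:(lra)).
    apply Rabs_le_between. lra.
  - rewrite <- energy_swap.
    apply (energy_nonpos_dominated Y _ M); [apply solution_swap, S' | | lra].
    intros y Hy. specialize (Hw y ltac:(lra)). specialize (Hz y ltac:(lra)).
    apply Rabs_le_between. lra.
  - rewrite <- energy_swap, <- energy_opp.
    apply (energy_nonpos_dominated Y _ M); [apply solution_opp, solution_swap, S' | | lra].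
    intros y Hy. specialize (Hw y ltac:(lra)). specialize (Hz y ltac:(lra)).
    apply Rabs_le_between. lra.
  - rewrite <- energy_opp.
    apply (energy_nonpos_dominated Y _ M); [apply solution_opp, S' | | lra].
    intros y Hy. specialize (Hw y ltac:(lra)). specialize (Hz y ltac:(lra)).
    apply Rabs_le_between. lra.
Qed.

(** * Solutions of nonpositive energy are constant *)

Lemma is_derive_slope_sqr_sum X beta M u u' v v' :
  bounded_ray_solution X beta M u u' v v' ->
  forall x, X < x ->
  is_derive (fun y => 2 * (u y * u' y + v y * v' y)) x
    (6 * (u' x ^ 2 + v' x ^ 2) - 4 * energy beta u u' v v' x).
Proof.
  intros [H1 H2 H3 H4 _ _ _ _] x Hx.
  specialize (H1 x Hx). specialize (H2 x Hx). specialize (H3 x Hx). specialize (H4 x Hx).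
  auto_derive.
  - repeat split; eexists; eassumption.
  - rewrite (Derive_eta _ _ _ H1), (Derive_eta _ _ _ H2),
      (Derive_eta _ _ _ H3), (Derive_eta _ _ _ H4). unfold energy. field.
Qed.

Lemma slope_sqr_sum_nonpos X beta M u u' v v' :
  bounded_ray_solution X beta M u u' v v' ->
  (forall x, X < x -> energy beta u u' v v' x <= 0) ->
  forall x, X < x -> u x * u' x + v x * v' x <= 0.
Proof.
  intros S HE x Hx.
  enough (2 * (u x * u' x + v x * v' x) <= 0) by lra.
  apply (bounded_convex_decreasing X (fun y => u y ^ 2 + v y ^ 2)
    (fun y => 2 * (u y * u' y + v y * v' y))
    (fun y => 6 * (u' y ^ 2 + v' y ^ 2) - 4 * energy beta u u' v v' y) (M ^ 2 + M ^ 2)); auto.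
  - intros y Hy. apply is_derive_sqr_sum; apply S; exact Hy.
  - apply (is_derive_slope_sqr_sum _ _ _ _ _ _ _ S).
  - intros y Hy.
    assert (u y ^ 2 <= M ^ 2) by (apply pow_maj_Rabs, S; exact Hy).
    assert (v y ^ 2 <= M ^ 2) by (apply pow_maj_Rabs, S; exact Hy).
    assert (P1 := pow2_ge_0 (u y)). assert (P2 := pow2_ge_0 (v y)).
    rewrite Rabs_pos_eq; lra.
  - intros y Hy. specialize (HE y Hy).
    assert (P1 := pow2_ge_0 (u' y)). assert (P2 := pow2_ge_0 (v' y)). lra.
Qed.

Lemma derivative_zero_of_zero_on_ray (X : R) (f : R -> R) (l x : R) :
  (forall y, X < y -> f y = 0) -> X < x -> is_derive f x l -> l = 0.
Proof.
  intros Hf Hx Hl. apply is_derive_unique in Hl. rewrite <- Hl.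
  apply is_derive_unique. apply (is_derive_ext_loc (fun _ => 0)).
  - apply (filter_imp (fun y => X < y)); [|apply (open_gt X), Hx].
    intros y Hy. symmetry. apply Hf, Hy.
  - apply (is_derive_const 0).
Qed.

(** The hypothesis on [u u' + v v'] is the half of the monotonicity of [u^2 + v^2]
    that a ray to [+oo] cannot provide; it comes from the other end of the
    interval. *)
Lemma static_solution X beta M u u' v v' :
  bounded_ray_solution X beta M u u' v v' ->
  (forall x, X < x -> energy beta u u' v v' x <= 0) ->
  (forall x, X < x -> 0 <= u x * u' x + v x * v' x) ->
  forall x, X < x -> u' x = 0 /\ v' x = 0.
Proof.
  intros S HE Hge x Hx.
  assert (Heq : forall y, X < y -> 2 * (u y * u' y + v y * v' y) = 0).
  { intros y Hy. assert (H := slope_sqr_sum_nonpos _ _ _ _ _ _ _ S HE y Hy).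
    specialize (Hge y Hy). lra. }
  assert (D := is_derive_slope_sqr_sum _ _ _ _ _ _ _ S x Hx).
  apply (derivative_zero_of_zero_on_ray X _ _ _ Heq Hx) in D.
  specialize (HE x Hx).
  assert (P1 := pow2_ge_0 (u' x)). assert (P2 := pow2_ge_0 (v' x)).
  split; apply Rsqr_0_uniq; unfold Rsqr; lra.
Qed.

Lemma constant_of_zero_slope X f f' :
  (forall x, X < x -> is_derive f x (f' x)) ->
  (forall x, X < x -> f' x = 0) ->
  forall a b, X < a -> X < b -> f a = f b.
Proof.
  intros Hf H0.
  assert (Hlt : forall a b, X < a -> a < b -> f a = f b).
  { intros a b Ha Hab.
    destruct (ray_mvt X f f' Hf a b Ha Hab) as [c [Hc E]].
    rewrite H0 in E by lra. lra. }
  intros a b Ha Hb. destruct (Rtotal_order a b) as [H | [-> | H]]; auto.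
  symmetry. auto.
Qed.

Lemma static_solution_eq X beta M u u' v v' :
  bounded_ray_solution X beta M u u' v v' ->
  (forall x, X < x -> u' x = 0 /\ v' x = 0) ->
  forall x, X < x ->
  u x ^ 3 + beta * u x * v x ^ 2 = 0 /\ v x ^ 3 + beta * u x ^ 2 * v x = 0.
Proof.
  intros [_ H2 _ H4 _ _ _ _] H0 x Hx.
  assert (Z1 := derivative_zero_of_zero_on_ray X u' _ x (fun y Hy => proj1 (H0 y Hy))
    Hx (H2 x Hx)).
  assert (Z2 := derivative_zero_of_zero_on_ray X v' _ x (fun y Hy => proj2 (H0 y Hy))
    Hx (H4 x Hx)).
  lra.
Qed.

Lemma equilibrium_zero beta p q :
  beta <> -1 ->
  p ^ 3 + beta * p * q ^ 2 = 0 -> q ^ 3 + beta * p ^ 2 * q = 0 -> p = 0 /\ q = 0.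
Proof.
  intros Hb E1 E2.
  assert (F1 : p * (p ^ 2 + beta * q ^ 2) = 0) by lra.
  assert (F2 : q * (q ^ 2 + beta * p ^ 2) = 0) by lra.
  destruct (Rmult_integral _ _ F1) as [Hp | Hp]; destruct (Rmult_integral _ _ F2) as [Hq | Hq].
  - auto.
  - subst p. split; [reflexivity|]. apply Rsqr_0_uniq. unfold Rsqr. lra.
  - subst q. split; [|reflexivity]. apply Rsqr_0_uniq. unfold Rsqr. lra.
  - assert (G : (1 + beta) * (p ^ 2 + q ^ 2) = 0) by lra.
    destruct (Rmult_integral _ _ G); [lra|].
    assert (P1 := pow2_ge_0 p). assert (P2 := pow2_ge_0 q).
    split; apply Rsqr_0_uniq; unfold Rsqr; lra.
Qed.

(** The two equations combine to [(p^2 - q^2)^2 = 0], the vanishing of the potential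
    part of the energy. *)
Lemma equilibrium_critical p q : p ^ 3 + -1 * p * q ^ 2 = 0 -> q ^ 3 + -1 * p ^ 2 * q = 0 ->
  q = p \/ q = - p.
Proof.
  intros E1 E2.
  assert (F : (p ^ 2 - q ^ 2) * (p ^ 2 - q ^ 2) = 0).
  { replace (_ * _) with (p * (p ^ 3 + -1 * p * q ^ 2) + q * (q ^ 3 + -1 * p ^ 2 * q)) by ring.
    rewrite E1, E2. ring. }
  assert (G : (q - p) * (q + p) = 0) by (apply Rmult_integral in F; lra).
  destruct (Rmult_integral _ _ G); lra.
Qed.

(** * Finite nodal number *)

Lemma sign_changes_extend (I : R -> Prop) (f : R -> R) m (x : nat -> R) y :
  (forall j : nat, (j <= m)%nat -> I (x j)) ->
  (forall j : nat, (j < m)%nat -> x j < x (S j)) ->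
  (forall j : nat, (j < m)%nat -> f (x j) * f (x (S j)) < 0) ->
  I y -> x m < y -> f (x m) * f y < 0 ->
  let x' := fun j => if le_dec j m then x j else y in
  (forall j : nat, (j <= S m)%nat -> I (x' j)) /\
  (forall j : nat, (j < S m)%nat -> x' j < x' (S j)) /\
  (forall j : nat, (j < S m)%nat -> f (x' j) * f (x' (S j)) < 0) /\
  x' (S m) = y.
Proof.
  intros HI Hlt Hs Hy Hxy Hfy x'.
  assert (Hlast : forall j, (m < j)%nat -> x' j = y).
  { intros j Hj. unfold x'. destruct (le_dec j m); [lia | reflexivity]. }
  assert (Hinit : forall j, (j <= m)%nat -> x' j = x j).
  { intros j Hj. unfold x'. destruct (le_dec j m); [reflexivity | lia]. }
  repeat split; intros.
  - destruct (le_dec j m); [rewrite Hinit by lia | rewrite Hlast by lia]; auto.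
  - rewrite Hinit by lia. destruct (Nat.eq_dec j m) as [-> | ].
    + rewrite Hlast by lia. exact Hxy.
    + rewrite Hinit by lia. apply Hlt. lia.
  - rewrite Hinit by lia. destruct (Nat.eq_dec j m) as [-> | ].
    + rewrite Hlast by lia. exact Hfy.
    + rewrite Hinit by lia. apply Hs. lia.
  - apply Hlast. lia.
Qed.

(** If both signs recur arbitrarily far out, any alternating sequence can be
    prolonged.  The induction carries that the last value is nonzero, which a
    sequence of length zero would not give. *)
Lemma finite_nodal_eventually_signed (I : R -> Prop) X f :
  (forall x, X < x -> I x) -> finite_nodal I f -> eventually_signed f.
Proof.
  intros HI Hfin. unfold finite_nodal, nodal_number in Hfin.
  destruct (excluded_middle_informative _) as [Hex | _]; [|congruence].
  clear Hfin. destruct Hex as [m [_ Hmax]]. apply NNPP. intros Hno.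
  assert (Hpos : forall Y, exists y, X < y /\ Y < y /\ 0 < f y).
  { intros Y. apply NNPP. intros H. apply Hno. exists (Rmax X Y). right.
    intros y Hy. apply Rnot_lt_le. intros Hf. apply H. exists y.
    apply Rmax_Rlt in Hy. tauto. }
  assert (Hneg : forall Y, exists y, X < y /\ Y < y /\ f y < 0).
  { intros Y. apply NNPP. intros H. apply Hno. exists (Rmax X Y). left.
    intros y Hy. apply Rnot_lt_le. intros Hf. apply H. exists y.
    apply Rmax_Rlt in Hy. tauto. }
  assert (Hall : forall k, exists x : nat -> R,
    (forall j : nat, (j <= k)%nat -> I (x j)) /\
    (forall j : nat, (j < k)%nat -> x j < x (S j)) /\
    (forall j : nat, (j < k)%nat -> f (x j) * f (x (S j)) < 0) /\ f (x k) <> 0).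
  { induction k as [|k [x [H1 [H2 [H3 H4]]]]].
    - destruct (Hpos X) as [y [Hy [_ Hf]]]. exists (fun _ => y).
      repeat split; intros; try lia; [auto | lra].
    - assert (Hy : exists y, X < y /\ x k < y /\ f (x k) * f y < 0).
      { destruct (Rtotal_order (f (x k)) 0) as [Hs | [Hs | Hs]]; [|contradiction|].
        - destruct (Hpos (x k)) as [y [Hy [Hxy Hf]]]. exists y. repeat split; auto. nra.
        - destruct (Hneg (x k)) as [y [Hy [Hxy Hf]]]. exists y. repeat split; auto. nra. }
      destruct Hy as [y [Hy [Hxy Hf]]].
      destruct (sign_changes_extend I f k x y H1 H2 H3 (HI y Hy) Hxy Hf) as [G1 [G2 [G3 G4]]].
      eexists. repeat split; [exact G1 | exact G2 | exact G3 |].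
      cbv beta in G4 |- *. rewrite G4. intros E. rewrite E in Hf. lra. }
  destruct (Hall (S m)) as [x [H1 [H2 [H3 _]]]].
  assert (S m <= m)%nat; [|lia].
  apply Hmax. exists x. auto.
Qed.

(** * The two problems *)

Lemma D_in_is_derive (I : R -> Prop) X f f' x :
  (forall y, X < y -> I y) -> X < x -> D_in f f' I x -> is_derive f x (f' x).
Proof.
  intros HI Hx HD. apply is_derive_Reals. intros eps Heps.
  destruct (HD eps Heps) as [a [Ha Hlim]].
  assert (Hd : 0 < Rmin a (x - X)) by (apply Rmin_glb_lt; lra).
  exists (mkposreal _ Hd). intros h Hh0 Hh. simpl in Hh.
  assert (Hh1 := Rlt_le_trans _ _ _ Hh (Rmin_l _ _)).
  assert (Hh2 := Rlt_le_trans _ _ _ Hh (Rmin_r _ _)).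
  apply Rabs_def2 in Hh2.
  specialize (Hlim (x + h)). simpl in Hlim. unfold Rdist in Hlim.
  replace (x + h - x) with h in Hlim by ring. apply Hlim.
  split; [split|exact Hh1].
  - apply HI. lra.
  - lra.
Qed.

Lemma Cb2_ray_solution (I : R -> Prop) beta u u' u'' v v' v'' :
  Cb2 I u u' u'' -> Cb2 I v v' v'' -> system I beta u v u'' v'' ->
  exists M, forall X, (forall x, X < x -> I x) -> bounded_ray_solution X beta M u u' v v'.
Proof.
  intros [U1 U2 _ [A0 HA0] [A1 HA1] _] [V1 V2 _ [B0 HB0] [B1 HB1] _] Hsys.
  exists (Rmax (Rmax A0 A1) (Rmax B0 B1)). intros X HI.
  split; intros x Hx; assert (Ix := HI x Hx).
  - apply (D_in_is_derive I X); auto.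
  - replace (- _) with (u'' x) by (destruct (Hsys x Ix); lra).
    apply (D_in_is_derive I X); auto.
  - apply (D_in_is_derive I X); auto.
  - replace (- _) with (v'' x) by (destruct (Hsys x Ix); lra).
    apply (D_in_is_derive I X); auto.
  - eapply Rle_trans; [apply HA0, Ix|]. eapply Rle_trans; [apply Rmax_l | apply Rmax_l].
  - eapply Rle_trans; [apply HA1, Ix|]. eapply Rle_trans; [apply Rmax_r | apply Rmax_l].
  - eapply Rle_trans; [apply HB0, Ix|]. eapply Rle_trans; [apply Rmax_l | apply Rmax_r].
  - eapply Rle_trans; [apply HB1, Ix|]. eapply Rle_trans; [apply Rmax_r | apply Rmax_r].
Qed.

(** The reflection [x -> - x] turns what is known at [+oo] into a statement at
    [-oo]. *)
Lemma solution_reflect X beta M u u' v v' :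
  (forall Y, bounded_ray_solution Y beta M u u' v v') ->
  bounded_ray_solution X beta M (fun x => u (- x)) (fun x => - u' (- x))
    (fun x => v (- x)) (fun x => - v' (- x)).
Proof.
  intros S.
  assert (Refl : forall (f : R -> R) l x, is_derive f (- x) l ->
    is_derive (fun y => f (- y)) x (- l)).
  { intros f l x H. auto_derive.
    - eexists; eassumption.
    - rewrite (Derive_eta _ _ _ H). ring. }
  split; intros x Hx; destruct (S (- x - 1)) as [H1 H2 H3 H4 B1 B2 B3 B4].
  - apply Refl, H1. lra.
  - replace (- (u (- x) ^ 3 + _))
      with (opp (- - (u (- x) ^ 3 + beta * u (- x) * v (- x) ^ 2))) by (unfold opp; simpl; ring).
    apply (is_derive_opp (fun y => u' (- y))), Refl, H2. lra.
  - apply Refl, H3. lra.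
  - replace (- (v (- x) ^ 3 + _))
      with (opp (- - (v (- x) ^ 3 + beta * u (- x) ^ 2 * v (- x)))) by (unfold opp; simpl; ring).
    apply (is_derive_opp (fun y => v' (- y))), Refl, H4. lra.
  - apply B1. lra.
  - rewrite Rabs_Ropp. apply B2. lra.
  - apply B3. lra.
  - rewrite Rabs_Ropp. apply B4. lra.
Qed.

Lemma constant_pair_conclusion (I : R -> Prop) beta u v p q :
  constant_pair I u v p q ->
  p ^ 3 + beta * p * q ^ 2 = 0 -> q ^ 3 + beta * p ^ 2 * q = 0 ->
  (beta <> -1 -> ~ nontrivial I u v) /\
  (beta = -1 -> exists c, constant_pair I u v c c \/ constant_pair I u v c (- c)).
Proof.
  intros Hc E1 E2. split.
  - intros Hb [x [Ix Hx]]. destruct (Hc x Ix) as [Eu Ev]. rewrite Eu, Ev in Hx.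
    destruct (equilibrium_zero beta p q Hb E1 E2). tauto.
  - intros ->. exists p. destruct (equilibrium_critical p q E1 E2); subst q; auto.
Qed.

Lemma solution_A_constant beta u v :
  finite_nodal no_cond (fun x => u x + v x) ->
  finite_nodal no_cond (fun x => u x - v x) ->
  solves_A beta u v ->
  exists p q, constant_pair no_cond u v p q /\
    p ^ 3 + beta * p * q ^ 2 = 0 /\ q ^ 3 + beta * p ^ 2 * q = 0.
Proof.
  intros Hw Hz (u' & u'' & v' & v'' & Hu & Hv & Hsys).
  assert (Hall : forall X x : R, X < x -> no_cond x) by (intros; exact I).
  apply (finite_nodal_eventually_signed _ 0 _ (Hall 0)) in Hw.
  apply (finite_nodal_eventually_signed _ 0 _ (Hall 0)) in Hz.
  destruct (Cb2_ray_solution _ _ _ _ _ _ _ _ Hu Hv Hsys) as [M S'].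
  assert (S := fun X => S' X (Hall X)).
  assert (HE : forall x, energy beta u u' v v' x <= 0).
  { intros x. apply (energy_nonpos (x - 1) _ M _ _ _ _ (S _) Hw Hz). lra. }
  assert (Hge : forall x, 0 <= u x * u' x + v x * v' x).
  { intros x.
    assert (H : u (- - x) * - u' (- - x) + v (- - x) * - v' (- - x) <= 0).
    { apply (slope_sqr_sum_nonpos (- x - 1) beta M (fun y => u (- y)) (fun y => - u' (- y))
        (fun y => v (- y)) (fun y => - v' (- y))); [|intros y _|lra].
      - apply solution_reflect, S.
      - replace (energy _ _ _ _ _ _) with (energy beta u u' v v' (- y))
          by (unfold energy; field).
        apply HE. }
    rewrite Ropp_involutive in H. lra. }
  assert (H0 : forall X x, X < x -> u' x = 0 /\ v' x = 0).
  { intros X. apply (static_solution X beta M _ _ _ _ (S X)); auto. }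
  exists (u 0), (v 0). split.
  - intros x _. set (X := Rmin x 0 - 1).
    assert (X < x) by (unfold X; assert (H := Rmin_l x 0); lra).
    assert (X < 0) by (unfold X; assert (H' := Rmin_r x 0); lra).
    split.
    + apply (constant_of_zero_slope X u u'); auto; [apply S | apply H0].
    + apply (constant_of_zero_slope X v v'); auto; [apply S | apply H0].
  - apply (static_solution_eq (-1) beta M u u' v v' (S _) (H0 _)). lra.
Qed.

Lemma continue_halfline_eps f e :
  continue_in f halfline 0 -> 0 < e ->
  exists a, 0 < a /\ forall y, 0 < y < a -> Rabs (f y - f 0) < e.
Proof.
  intros Hf He. destruct (Hf e He) as [a [Ha H]]. exists a. split; [exact Ha|].
  intros y Hy. apply (H y). simpl. unfold Rdist, D_x, halfline.
  rewrite Rabs_pos_eq; lra.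
Qed.

Lemma halfline_constant_value f c :
  continue_in f halfline 0 -> (forall x, 0 < x -> f x = c) -> f 0 = c.
Proof.
  intros Hf Hc. apply NNPP. intros Hne.
  destruct (continue_halfline_eps f (Rabs (c - f 0)) Hf) as [a [Ha H]].
  { apply Rabs_pos_lt. lra. }
  specialize (H (a / 2) ltac:(lra)). rewrite Hc in H by lra. lra.
Qed.

Lemma solution_B_constant beta u v :
  finite_nodal halfline (fun x => u x + v x) ->
  finite_nodal halfline (fun x => u x - v x) ->
  solves_B beta u v ->
  exists p q, constant_pair halfline u v p q /\
    p ^ 3 + beta * p * q ^ 2 = 0 /\ q ^ 3 + beta * p ^ 2 * q = 0.
Proof.
  intros Hw Hz (u' & u'' & v' & v'' & Hu & Hv & Hsys & Hu0 & Hv0).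
  assert (Hall : forall x : R, 0 < x -> halfline x) by (unfold halfline; intros; lra).
  apply (finite_nodal_eventually_signed _ 0 _ Hall) in Hw.
  apply (finite_nodal_eventually_signed _ 0 _ Hall) in Hz.
  destruct (Cb2_ray_solution _ _ _ _ _ _ _ _ Hu Hv Hsys) as [M S].
  specialize (S 0 Hall).
  assert (HE : forall x, 0 < x -> energy beta u u' v v' x <= 0).
  { exact (energy_nonpos 0 _ M _ _ _ _ S Hw Hz). }
  assert (H00 : halfline 0) by (unfold halfline; lra).
  assert (Hge : forall x, 0 < x -> 0 <= u x * u' x + v x * v' x).
  { intros x Hx. apply Rnot_lt_le. intros Hneg.
    (* [u u' + v v'] is nondecreasing and tends to [0] at [0]; [e] is chosen so that
       [|u'|, |v'| < e] gives [|u u' + v v'| < c]. *)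
    set (c := - (u x * u' x + v x * v' x)).
    assert (Hc : 0 < c) by (unfold c; lra).
    assert (HM : 0 <= M).
    { apply Rle_trans with (Rabs (u x)); [apply Rabs_pos | apply S, Hx]. }
    assert (He : 0 < c / (2 * M + 1)) by (apply Rdiv_lt_0_compat; lra).
    set (e := c / (2 * M + 1)) in *.
    assert (Ee : (2 * M + 1) * e = c) by (unfold e; field; lra).
    destruct (continue_halfline_eps u' e) as [a [Ha Ka]]; auto.
    { apply (cont_deriv _ u''), (Cb2_deriv2 _ _ _ _ Hu), H00. }
    destruct (continue_halfline_eps v' e) as [b [Hb Kb]]; auto.
    { apply (cont_deriv _ v''), (Cb2_deriv2 _ _ _ _ Hv), H00. }
    assert (Hy : 0 < Rmin x (Rmin a b)) by (repeat apply Rmin_glb_lt; assumption).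
    set (y := Rmin x (Rmin a b) / 2).
    assert (Ly1 := Rmin_l x (Rmin a b)). assert (Ly2 := Rmin_r x (Rmin a b)).
    assert (Ly3 := Rmin_l a b). assert (Ly4 := Rmin_r a b).
    specialize (Ka y ltac:(unfold y; lra)). specialize (Kb y ltac:(unfold y; lra)).
    rewrite Hu0, Rminus_0_r in Ka. rewrite Hv0, Rminus_0_r in Kb.
    assert (Hinc : 2 * (u y * u' y + v y * v' y) <= 2 * (u x * u' x + v x * v' x)).
    { apply (ray_le 0 (fun z => 2 * (u z * u' z + v z * v' z)) _
        (is_derive_slope_sqr_sum _ _ _ _ _ _ _ S)); [|unfold y; lra|unfold y; lra].
      intros z Hz'. specialize (HE z Hz').
      assert (P1 := pow2_ge_0 (u' z)). assert (P2 := pow2_ge_0 (v' z)). lra. }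
    assert (Hy0 : 0 < y) by (unfold y; lra).
    assert (Q : forall p q, Rabs p <= M -> Rabs q < e -> - (M * e) <= p * q).
    { intros p q Hp Hq.
      assert (Rabs (p * q) <= M * e).
      { rewrite Rabs_mult. apply Rmult_le_compat; try apply Rabs_pos; lra. }
      apply Rabs_le_between in H. lra. }
    assert (Q1 := Q _ _ (bound_u _ _ _ _ _ _ _ S y Hy0) Ka).
    assert (Q2 := Q _ _ (bound_v _ _ _ _ _ _ _ S y Hy0) Kb).
    unfold c in *. lra. }
  assert (H0 := static_solution 0 beta M _ _ _ _ S HE Hge).
  assert (Cu : forall x, 0 < x -> u x = u 1).
  { intros x Hx. apply (constant_of_zero_slope 0 u u'); [apply S | apply H0 | lra | lra]. }
  assert (Cv : forall x, 0 < x -> v x = v 1).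
  { intros x Hx. apply (constant_of_zero_slope 0 v v'); [apply S | apply H0 | lra | lra]. }
  exists (u 1), (v 1). split.
  - intros x [Hx | <-]; [auto|].
    split; apply halfline_constant_value; auto.
    + apply (cont_deriv _ u'), (Cb2_deriv1 _ _ _ _ Hu), H00.
    + apply (cont_deriv _ v'), (Cb2_deriv1 _ _ _ _ Hv), H00.
  - apply (static_solution_eq 0 beta M u u' v v' S H0). lra.
Qed.


Theorem theorem1p6 :
  forall beta : R,
    (beta <> -1 ->
       (~ exists u v : R -> R,
            finite_nodal no_cond (fun x => u x + v x) /\
            finite_nodal no_cond (fun x => u x - v x) /\
            solves_A beta u v /\ nontrivial no_cond u v) /\
       (~ exists u v : R -> R,
            finite_nodal halfline (fun x => u x + v x) /\
            finite_nodal halfline (fun x => u x - v x) /\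
            solves_B beta u v /\ nontrivial halfline u v)) /\
    (beta = -1 ->
       (forall u v : R -> R,
          finite_nodal no_cond (fun x => u x + v x) ->
          finite_nodal no_cond (fun x => u x - v x) ->
          solves_A beta u v ->
          exists c : R,
            constant_pair no_cond u v c c \/ constant_pair no_cond u v c (- c)) /\
       (forall u v : R -> R,
          finite_nodal halfline (fun x => u x + v x) ->
          finite_nodal halfline (fun x => u x - v x) ->
          solves_B beta u v ->
          exists c : R,
            constant_pair halfline u v c c \/ constant_pair halfline u v c (- c))).

Proof.
  intros beta.
  assert (HA : forall u v,
    finite_nodal no_cond (fun x => u x + v x) ->
    finite_nodal no_cond (fun x => u x - v x) -> solves_A beta u v ->
    (beta <> -1 -> ~ nontrivial no_cond u v) /\
    (beta = -1 -> exists c,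
      constant_pair no_cond u v c c \/ constant_pair no_cond u v c (- c))).
  { intros u v Hw Hz HS.
    destruct (solution_A_constant beta u v Hw Hz HS) as (p & q & Hc & E1 & E2).
    exact (constant_pair_conclusion _ _ _ _ _ _ Hc E1 E2). }
  assert (HB : forall u v,
    finite_nodal halfline (fun x => u x + v x) ->
    finite_nodal halfline (fun x => u x - v x) -> solves_B beta u v ->
    (beta <> -1 -> ~ nontrivial halfline u v) /\
    (beta = -1 -> exists c,
      constant_pair halfline u v c c \/ constant_pair halfline u v c (- c))).
  { intros u v Hw Hz HS.
    destruct (solution_B_constant beta u v Hw Hz HS) as (p & q & Hc & E1 & E2).
    exact (constant_pair_conclusion _ _ _ _ _ _ Hc E1 E2). }
  split; intros Hbeta; split.
  - intros (u & v & Hw & Hz & HS & Hnt). exact (proj1 (HA u v Hw Hz HS) Hbeta Hnt).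
  - intros (u & v & Hw & Hz & HS & Hnt). exact (proj1 (HB u v Hw Hz HS) Hbeta Hnt).
  - intros u v Hw Hz HS. exact (proj2 (HA u v Hw Hz HS) Hbeta).
  - intros u v Hw Hz HS. exact (proj2 (HB u v Hw Hz HS) Hbeta).
Qed.
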